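(* Let $G$ be a connected graph on $n$ vertices. For a graph $H$ on $n$ vertices define $$RL(H):=\sum_{i=1}^n\frac1{n+1-\lambda_i(L(H))},\qquad RQ(H):=\sum_{i=1}^n\frac1{2n-1-\lambda_i(Q(H))}.$$ Then $$RL(G)\ge RL(P_n),\qquad RQ(G)\ge RQ(P_n).$$
   Context: All graphs are finite, simple, undirected and unweighted. For a graph $G$, $A(G)$ is the adjacency matrix, $D(G)$ the diagonal matrix of vertex degrees, $L(G)=D(G)-A(G)$ the Laplacian matrix and $Q(G)=D(G)+A(G)$ the signless Laplacian matrix. For a real symmetric matrix $M$, $\lambda_1(M)\ge\lambda_2(M)\ge\cdots$ are its eigenvalues repeated with multiplicity. $P_n$ denotes the path on $n$ vertices ($P_1$ is a single vertex). *)

(* Defs.v *)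
From HB Require Import structures.
From mathcomp Require Import all_boot all_order all_algebra.
From mathcomp Require Import spectral sesquilinear.
From mathcomp Require Import polyrcf complex.
From mathcomp Require Import reals.

Set Implicit Arguments.
Unset Strict Implicit.
Unset Printing Implicit Defensive.

Import Order.TTheory GRing.Theory Num.Theory.
Local Open Scope ring_scope.

Record sgraph (n : nat) := SGraph {
  adj :> rel 'I_n;
  adj_sym : symmetric adj;
  adj_irr : irreflexive adj }.

Definition connected_graph n (G : sgraph n) : Prop :=
  forall x y : 'I_n, connect G x y.

Definition degree n (G : sgraph n) (x : 'I_n) : nat := #|[set y | G x y]|.

Definition path_rel n : rel 'I_n :=
  [rel i j : 'I_n | ((i.+1 == j :> nat) || (j.+1 == i :> nat))%N].

Lemma path_rel_sym n : symmetric (@path_rel n).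
Proof. by move=> i j; rewrite /path_rel /= orbC. Qed.

Lemma path_rel_irr n : irreflexive (@path_rel n).
Proof. by move=> i; rewrite /path_rel /= orbb gtn_eqF. Qed.

Definition path_graph n : sgraph n := SGraph (@path_rel_sym n) (@path_rel_irr n).

Section Spectrum.
Variable R : realType.

Definition adjmx n (G : sgraph n) : 'M[R]_n := \matrix_(i, j) (G i j)%:R.

Definition degmx n (G : sgraph n) : 'M[R]_n :=
  diag_mx (\row_i (degree G i)%:R).

Definition laplacian n (G : sgraph n) : 'M[R]_n := degmx G - adjmx G.

Definition signless_laplacian n (G : sgraph n) : 'M[R]_n := degmx G + adjmx G.

(* The real roots of the characteristic polynomial, repeated with algebraic
   multiplicity, in nonincreasing order. For a symmetric matrix these are all
   its eigenvalues, see char_poly_eigvals and size_eigvals below. *)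
Definition eigvals n (M : 'M[R]_n) : seq R :=
  sort >=%R (flatten [seq nseq (mup x (char_poly M)) x
                     | x <- rootsR (char_poly M)]).

(* 0-based: lambda M i is the (i+1)-st largest eigenvalue. *)
Definition lambda n (M : 'M[R]_n) (i : nat) : R := (eigvals M)`_i.

Definition RL n (H : sgraph n) : R :=
  \sum_(i < n) 1 / (n%:R + 1 - lambda (laplacian H) i).

Definition RQ n (H : sgraph n) : R :=
  \sum_(i < n) 1 / (2 * n%:R - 1 - lambda (signless_laplacian H) i).

Lemma sym_char_poly_split n (M : 'M[R]_n) : M^T = M ->
  exists2 s : seq R, size s = n & char_poly M = \prod_(x <- s) ('X - x%:P).
Proof.
move=> Msym; pose toC := real_complex R.
pose A : 'M[R[i]]_n := map_mx toC M.
have Ah : A \is hermsymmx.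
  apply: realsym_hermsym.
    apply/is_hermitianmxP; rewrite expr0 scale1r map_mx_id //.
    by rewrite /A -[in LHS]Msym map_trmx.
  by apply/mxOverP => i j; rewrite mxE complex_real.
have /orthomx_spectralP AE := hermitian_normalmx Ah.
have /mxOverP dR := hermitian_spectral_diag_real Ah.
set P := spectralmx A in AE; set d := spectral_diag A in AE dR.
have Pu : P \in unitmx by apply: spectral_unit.
have cA : char_poly A = \prod_(i < n) ('X - (d 0 i)%:P).
  have -> : char_poly A = char_poly (diag_mx d).
    rewrite /char_poly /char_poly_mx AE !map_mxM /= map_invmx.
    set Q := map_mx _ P.
    have Qu : Q \in unitmx by rewrite map_unitmx.
    rewrite -[X in X - _](_ : invmx Q *m 'X%:M *m Q = _); last first.
      by rewrite -mulmxA -scalar_mxC mulmxA mulVmx // mul1mx.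
    rewrite -mulmxBl -mulmxBr !det_mulmx mulrAC -det_mulmx mulVmx //.
    by rewrite det1 mul1r.
  rewrite char_poly_trig ?diag_mx_is_trig //.
  by apply: eq_bigr => i _; rewrite mxE eqxx mulr1n.
exists [seq complex.Re (d 0 i) | i <- enum 'I_n]; first by rewrite size_map size_enum_ord.
apply: (@map_poly_inj _ _ toC).
rewrite map_char_poly -/A cA rmorph_prod big_map enumT /=.
apply: eq_bigr => i _.
rewrite rmorphB /= map_polyX map_polyC /=.
by rewrite /toC /= RRe_real // dR.
Qed.

Lemma char_poly_eigvals n (M : 'M[R]_n) : M^T = M ->
  char_poly M = \prod_(x <- eigvals M) ('X - x%:P).
Proof.
move=> Msym; have [s _ cM] := sym_char_poly_split Msym.
have p0 : char_poly M != 0 by rewrite monic_neq0 ?char_poly_monic.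
rewrite [LHS]cM; apply/perm_big; rewrite perm_sym /eigvals perm_sort.
rewrite (@eq_map _ _ _ (fun x => nseq (count_mem x s) x)); last first.
  by move=> x; rewrite cM mu_prod_XsubC.
apply: perm_trans (perm_count_undup s); apply/perm_flatten/perm_map.
apply: uniq_perm; rewrite ?undup_uniq ?uniq_roots // => x.
have /(_ x) := roots_on_rootsR p0.
by rewrite mem_undup /= => <-; rewrite cM root_prod_XsubC.
Qed.

Lemma eigvals_sorted n (M : 'M[R]_n) : sorted >=%R (eigvals M).
Proof. by apply: sort_sorted => x y; rewrite /= le_total. Qed.

Lemma size_eigvals n (M : 'M[R]_n) : M^T = M -> size (eigvals M) = n.
Proof.
move=> Msym; apply/eq_add_S.
by rewrite -(size_prod_XsubC (eigvals M) id) -char_poly_eigvals // size_char_poly.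
Qed.

Lemma laplacian_sym n (G : sgraph n) : (laplacian G)^T = laplacian G.
Proof.
rewrite /laplacian linearB /= tr_diag_mx; congr (_ - _).
by apply/matrixP => i j; rewrite !mxE adj_sym.
Qed.

Lemma signless_laplacian_sym n (G : sgraph n) :
  (signless_laplacian G)^T = signless_laplacian G.
Proof.
rewrite /signless_laplacian linearD /= tr_diag_mx; congr (_ + _).
by apply/matrixP => i j; rewrite !mxE adj_sym.
Qed.

End Spectrum.

(* Main.v *)
Require Import Defs.
From mathcomp Require Import all_boot all_order all_algebra reals.
From mathcomp Require Import fingroup perm.
From mathcomp Require Import spectral sesquilinear complex.
From mathcomp Require Import ring lra zify.
Set Implicit Arguments.
Unset Strict Implicit.
Unset Printing Implicit Defensive.
Import Order.TTheory GRing.Theory Num.Theory.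
Local Open Scope ring_scope.

(** Both quantities are traces of resolvents.  Write [K = D + e A] with [e = -1]
    for the Laplacian and [e = 1] for the signless Laplacian, let [c] be [n + 1]
    or [2 n - 1], and put [m = l - 2] for an eigenvalue [l] of [K], and
    [x = c - 2].  The sum to compare is that of [1 / (x - m)].  Its expansion in
    powers of [1 / x] has the sums of [m ^+ k] as coefficients, and [x] is at
    least of the order of [n]; hence the first coefficient at which [G] differs
    from the path decides the comparison, and all the rest is a matter of crude
    estimates.  No eigenvalue has to be computed.

    The sums of [m], [m ^+ 2] and [m ^+ 3] are the traces of the powers of
    [K - 2], which are sums over the vertices of polynomials in the degree, plus
    a term counting triangles ([shifted_power_sums]).  For every [G] the
    function [1 / (x - m)] is bounded from below by a cubic polynomial in [m],
    as [m] lies in [[-2, x[] ([resolvent_sum_ge]).  For the path it is bounded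
    from above by another one, as [m] lies in [[-2, 2]] ([resolvent_sum_le]).

    A connected graph has at least [n - 1] edges, so three cases are left.
    - There are [n - 1] edges and all degrees are at most 2.  A longest path is
      then Hamiltonian and has all the edges: [G] is isomorphic to the path
      ([path_iso]).
    - There are [n - 1] edges and some degree is at least 3.  The first moments
      agree, but the second one exceeds that of the path by at least 2, and the
      third one is under control since there is no triangle ([moments_tree]).
    - There are at least [n] edges.  The first moment exceeds that of the path
      by at least 2, the second one is not smaller, and the third one is bounded
      from below by bounding the number of triangles ([moments_cyclic]).
    In the last two cases the excess beats the gap between the two cubic bounds
    as soon as [x] is at least 3 ([tree_estimate], [cyclic_estimate]).  What
    remains is the Laplacian for [n = 3], where [x = 2] and the interval
    [[-2, 2]] of the path has to be replaced by [[-2, 1]]. *)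

(** * Power sums of the eigenvalues of a symmetric matrix *)

Lemma char_poly_conj (F : fieldType) n (P B : 'M[F]_n) : P \in unitmx ->
  char_poly (invmx P *m B *m P) = char_poly B.
Proof.
move=> Pu; rewrite /char_poly /char_poly_mx !map_mxM /= map_invmx.
set Q := map_mx _ P.
have Qu : Q \in unitmx by rewrite map_unitmx.
have XE : invmx Q *m 'X%:M *m Q = 'X%:M.
  by rewrite -mulmxA -scalar_mxC mulmxA mulVmx // mul1mx.
rewrite -[in LHS]XE.
rewrite -mulmxBl -mulmxBr !det_mulmx mulrAC -det_mulmx mulVmx //.
by rewrite det1 mul1r.
Qed.

Lemma exp_conjmx (F : fieldType) n (P B : 'M[F]_n) k : P \in unitmx ->
  (invmx P *m B *m P) ^+ k = invmx P *m B ^+ k *m P.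
Proof.
move=> Pu; elim: k => [|k IH]; first by rewrite !expr0 mulmx1 mulVmx.
by rewrite !exprS IH -!mulmxE !mulmxA mulmxK.
Qed.

Lemma exp_diag_mx (F : fieldType) n (d : 'rV[F]_n) k :
  diag_mx d ^+ k = diag_mx (\row_i d 0 i ^+ k).
Proof.
elim: k => [|k IH].
  rewrite expr0 -[LHS]diag_const_mx; congr diag_mx.
  by apply/rowP => i; rewrite !mxE.
rewrite exprS IH -mulmxE mulmx_diag; congr diag_mx.
by apply/rowP => i; rewrite !mxE exprS.
Qed.

Lemma sym_diagonalizable (R : realType) n (M : 'M[R]_n) : M^T = M ->
  exists2 P : 'M[R[i]]_n, P \in unitmx &
    exists d : 'rV[R[i]]_n,
      map_mx (real_complex R) M = invmx P *m diag_mx d *m P.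
Proof.
move=> Msym; set A := map_mx _ M.
have Ah : A \is hermsymmx.
  apply: realsym_hermsym.
    apply/is_hermitianmxP; rewrite expr0 scale1r map_mx_id //.
    by rewrite /A -[in LHS]Msym map_trmx.
  by apply/mxOverP => i j; rewrite mxE complex_real.
have /orthomx_spectralP AE := hermitian_normalmx Ah.
exists (spectralmx A); first exact: spectral_unit.
by exists (spectral_diag A).
Qed.

(** The diagonalization lives over the complex numbers; the diagonal entries are
    the eigenvalues because a product of linear factors determines its roots. *)
Lemma sum_eigvals_pow (R : realType) n (M : 'M[R]_n) k : M^T = M ->
  \sum_(l <- eigvals M) l ^+ k = \tr (M ^+ k).
Proof.
move=> Msym; set toC := real_complex R.
have [P Pu [d AE]] := sym_diagonalizable Msym.
set A := map_mx _ M in AE.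
have powE : A ^+ k = invmx P *m diag_mx (\row_i d 0 i ^+ k) *m P.
  rewrite AE (exp_conjmx _ _ Pu) exp_diag_mx; reflexivity.
have dperm : perm_eq [seq toC l | l <- eigvals M] [seq d 0 i | i <- enum 'I_n].
  apply: prod_XsubC_eq; rewrite !big_map -[in RHS]enumT big_enum /=.
  transitivity (char_poly A).
    rewrite /A -map_char_poly char_poly_eigvals // rmorph_prod /=.
    by apply: eq_bigr => l _; rewrite rmorphB /= map_polyX map_polyC.
  rewrite AE char_poly_conj // char_poly_trig ?diag_mx_is_trig //.
  by apply: eq_bigr => i _; rewrite mxE eqxx mulr1n.
have powM : map_mx toC (M ^+ k) = A ^+ k.
  elim: k {powE} => [|k IH]; first exact: map_mx1.
  by rewrite !exprS -!mulmxE map_mxM IH.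
apply: (fmorph_inj toC); rewrite -trace_map_mx powM powE mxtrace_mulC mulmxA.
rewrite mulmxV // mul1mx mxtrace_diag rmorph_sum /=.
transitivity (\sum_(z <- [seq toC l | l <- eigvals M]) z ^+ k).
  by rewrite big_map; apply: eq_bigr => l _; rewrite rmorphXn.
rewrite (perm_big _ dperm) big_map big_enum /=.
by apply: eq_bigr => i _; rewrite mxE.
Qed.

(** Evaluating the quadratic form of [M] at an eigenvector for [l] gives [l]
    times the squared norm, so that any bound on the form bounds [l]. *)
Lemma eigvals_quadratic (R : realType) n (M : 'M[R]_n) l : l \in eigvals M ->
  M^T = M ->
  exists2 v : 'I_n -> R, 0 < \sum_i v i ^+ 2 &
    \sum_i \sum_j M i j * (v i * v j) = l * \sum_i v i ^+ 2.
Proof.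
move=> lM Msym.
have : eigenvalue M l.
  by rewrite eigenvalue_root_char char_poly_eigvals // root_prod_XsubC.
case/eigenvalueP => v vM v0; exists (fun i => v 0 i).
  rewrite lt_neqAle sumr_ge0 ?andbT => [|i _]; last exact: sqr_ge0.
  apply: contra v0; rewrite eq_sym psumr_eq0 => [|i _]; last exact: sqr_ge0.
  move/allP => v0; apply/eqP/rowP => i; rewrite mxE; apply/eqP.
  by rewrite -sqrf_eq0; apply: v0; rewrite mem_index_enum.
rewrite exchange_big mulr_sumr; apply: eq_bigr => j _ /=.
move/rowP: vM => /(_ j); rewrite !mxE => vMj.
rewrite expr2 mulrA -vMj mulr_suml; apply: eq_bigr => i _.
by rewrite mulrA [M i j * _]mulrC.
Qed.

(** * Laplacian matrices: traces of powers and quadratic form *)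

Lemma degreeE n (G : sgraph n) i : degree G i = (\sum_j G i j)%N.
Proof.
rewrite /degree cardsE -sum1_card big_mkcond /=.
by apply: eq_bigr => j _; rewrite -topredE /=; case: (G i j).
Qed.

Section Traces.
Variables (R : realType) (n : nat) (G : sgraph n).
Implicit Type e : R.

Definition deg i : R := (degree G i)%:R.

(** The number of closed walks of length 3: each triangle is counted six
    times. *)
Definition triangles : R := \sum_i \sum_j \sum_k (G i j && G j k && G k i)%:R.

(** The Laplacian for [e = -1] and the signless Laplacian for [e = 1]; nearly
    everything below uses [e] through [e ^+ 2 = 1] only. *)
Definition signed_laplacian e : 'M[R]_n := degmx R G + e *: adjmx R G.

Lemma deg_sum i : deg i = \sum_j (G i j)%:R.
Proof. by rewrite /deg degreeE natr_sum. Qed.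

Lemma slap_sym e : (signed_laplacian e)^T = signed_laplacian e.
Proof.
apply/matrixP => i j; rewrite !mxE adj_sym; congr (_ + _).
by case: eqVneq => [->|]; rewrite ?eqxx // eq_sym => /negPf->.
Qed.

Lemma trace_slap1 e : \tr (signed_laplacian e ^+ 1) = \sum_i deg i.
Proof.
rewrite expr1; apply: eq_bigr => i _.
by rewrite !mxE eqxx mulr1n adj_irr mulr0 addr0.
Qed.

Lemma adjmx_sqr_diag i : (adjmx R G *m adjmx R G) i i = deg i.
Proof.
rewrite mxE deg_sum; apply: eq_bigr => j _; rewrite !mxE (adj_sym _ j i).
by rewrite -natrM mulnb andbb.
Qed.

Lemma trace_diag_adj (u : 'rV[R]_n) : \tr (diag_mx u *m adjmx R G) = 0.
Proof.
by apply: big1 => i _; rewrite mul_diag_mx !mxE adj_irr mulr0.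
Qed.

Lemma trace_diag_adj2 (u : 'rV[R]_n) :
  \tr (diag_mx u *m (adjmx R G *m adjmx R G)) = \sum_i u 0 i * deg i.
Proof.
by apply: eq_bigr => i _; rewrite mul_diag_mx mxE adjmx_sqr_diag.
Qed.

Lemma trace_adj3 : \tr (adjmx R G *m adjmx R G *m adjmx R G) = triangles.
Proof.
rewrite -mulmxA; apply: eq_bigr => i _; rewrite mxE; apply: eq_bigr => j _.
rewrite !mxE mulr_sumr; apply: eq_bigr => k _.
by rewrite !mxE -!natrM !mulnb andbA.
Qed.

Lemma trace_slap2 e : e ^+ 2 = 1 ->
  \tr (signed_laplacian e ^+ 2) = \sum_i (deg i ^+ 2 + deg i).
Proof.
move=> e1; rewrite expr2 -mulmxE /signed_laplacian.
rewrite mulmxDl !mulmxDr -!scalemxAl -!scalemxAr scalerA -expr2 e1 scale1r.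
rewrite !mxtraceD !mxtraceZ [\tr (adjmx R G *m degmx R G)]mxtrace_mulC.
rewrite trace_diag_adj.
rewrite !mulr0 addr0 add0r mulmx_diag mxtrace_diag big_split; congr (_ + _).
  by apply: eq_bigr => i _; rewrite !mxE expr2.
by apply: eq_bigr => i _; rewrite adjmx_sqr_diag.
Qed.

(** Expanding the cube, the words with one [A] have zero trace, those with two
    give the sum of the squared degrees, and [A ^ 3] counts triangles. *)
Lemma trace_slap3 e : e ^+ 2 = 1 ->
  \tr (signed_laplacian e ^+ 3) =
  \sum_i (deg i ^+ 3 + 3 * deg i ^+ 2) + e * triangles.
Proof.
move=> e1; rewrite exprS expr2 -!mulmxE /signed_laplacian -trace_adj3.
set A := adjmx R G; set D := degmx R G.
have DD : D *m D = diag_mx (\row_i deg i ^+ 2).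
  by rewrite mulmx_diag; congr diag_mx; apply/rowP => i; rewrite !mxE expr2.
have DDD : \tr (D *m D *m D) = \sum_i deg i ^+ 3.
  rewrite DD mulmx_diag mxtrace_diag; apply: eq_bigr => i _.
  by rewrite !mxE -exprSr.
have DDA : \tr (D *m D *m A) = 0 by rewrite DD trace_diag_adj.
have DAA : \tr (D *m (A *m A)) = \sum_i deg i ^+ 2.
  by rewrite trace_diag_adj2; apply: eq_bigr => i _; rewrite mxE expr2.
rewrite !mulmxDl !mulmxDr -!(scalemxAl, scalemxAr) !scalerA.
rewrite !mxtraceD !mxtraceZ !mulmxA -!expr2 e1.
have DAD : \tr (D *m A *m D) = 0 by rewrite mxtrace_mulC mulmxA.
have ADD : \tr (A *m D *m D) = 0 by rewrite -mulmxA mxtrace_mulC.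
have AAD : \tr (A *m A *m D) = \sum_i deg i ^+ 2 by rewrite mxtrace_mulC.
have ADA : \tr (A *m D *m A) = \sum_i deg i ^+ 2.
  by rewrite mxtrace_mulC mulmxA.
rewrite -(mulmxA D A A) DDD DDA DAA DAD ADD AAD ADA.
rewrite big_split /= -mulr_sumr.
ring.
Qed.

Lemma triangles_ge0 : 0 <= triangles.
Proof. by do 3!(apply: sumr_ge0 => ? _); rewrite ler0n. Qed.

(** A closed walk of length 3 from [i] is given by two distinct neighbours of
    [i]. *)
Lemma triangles_le : triangles <= \sum_i (deg i ^+ 2 - deg i).
Proof.
apply: ler_sum => i _.
have -> : deg i ^+ 2 - deg i = \sum_j (G i j)%:R * (deg i - 1).
  by rewrite -mulr_suml -deg_sum mulrBr mulr1 expr2.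
apply: ler_sum => j _; case Gij: (G i j); last by rewrite big1 ?mul0r.
rewrite mul1r deg_sum (bigD1 j) //= adj_irr add0r.
rewrite [X in _ <= X - 1](bigD1 j) //= Gij addrAC subrr add0r.
apply: ler_sum => k _.
by rewrite (adj_sym _ k); case: (G i k); case: (G j k); rewrite ?lexx ?ler01.
Qed.

Lemma sum_adj_l (v : 'I_n -> R) :
  \sum_i \sum_j (G i j)%:R * v i ^+ 2 = \sum_i deg i * v i ^+ 2.
Proof. by apply: eq_bigr => i _; rewrite deg_sum mulr_suml. Qed.

Lemma sum_adj_r (v : 'I_n -> R) :
  \sum_i \sum_j (G i j)%:R * v j ^+ 2 = \sum_i deg i * v i ^+ 2.
Proof.
rewrite exchange_big -sum_adj_l; apply: eq_bigr => i _.
by apply: eq_bigr => j _ /=; rewrite adj_sym.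
Qed.

(** The incidence form of the Laplacian quadratic form: every edge occurs
    twice in the double sum, once for each orientation. *)
Lemma slap_quadratic e (v : 'I_n -> R) : e ^+ 2 = 1 ->
  \sum_i \sum_j signed_laplacian e i j * (v i * v j) =
  2^-1 * \sum_i \sum_j (G i j)%:R * (v i + e * v j) ^+ 2.
Proof.
move=> e1.
have E : \sum_i \sum_j (G i j)%:R * (v i + e * v j) ^+ 2 =
  2 * \sum_i deg i * v i ^+ 2 + 2 * \sum_i \sum_j e * (G i j)%:R * (v i * v j).
  rewrite mulr_natl mulr2n -{1}sum_adj_l -sum_adj_r mulr_sumr -!big_split /=.
  apply: eq_bigr => i _; rewrite mulr_sumr -!big_split /=.
  apply: eq_bigr => j _; rewrite sqrrD exprMn e1 mul1r.
  by case: (G i j); rewrite /= ?mulr0 ?mul0r ?mul1r ?mulr1; ring.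
rewrite E -mulrDr mulKf ?pnatr_eq0 // -big_split; apply: eq_bigr => i _ /=.
rewrite (bigD1 i) //= [in RHS](bigD1 i) //= addrA; congr (_ + _).
  by rewrite !mxE eqxx adj_irr mulr1n; ring.
by apply: eq_bigr => j ji; rewrite !mxE eq_sym (negPf ji) mulr0n add0r.
Qed.

End Traces.

(** * Location of the spectra *)

Section Spectrum.
Variables (R : realType) (n : nat) (G : sgraph n).
Implicit Types e l : R.

Lemma slap_eigval_ge0 e l : e ^+ 2 = 1 ->
  l \in eigvals (signed_laplacian G e) -> 0 <= l.
Proof.
move=> e1 /eigvals_quadratic[|v v0]; first exact: slap_sym.
rewrite slap_quadratic // => vl; rewrite -(pmulr_lge0 _ v0) -vl.
rewrite mulr_ge0 ?invr_ge0 ?ler0n //.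
by do 2!(apply: sumr_ge0 => ? _); rewrite mulr_ge0 ?sqr_ge0 ?ler0n.
Qed.

(** From [(a + e b) ^+ 2 <= 2 (a ^+ 2 + b ^+ 2)] on each edge. *)
Lemma slap_eigval_le e l D : e ^+ 2 = 1 -> (forall i, degree G i <= D)%N ->
  l \in eigvals (signed_laplacian G e) -> l <= 2 * D%:R.
Proof.
move=> e1 GD /eigvals_quadratic[|v v0]; first exact: slap_sym.
rewrite slap_quadratic // => vl; rewrite -(ler_pM2r v0) -vl.
rewrite ler_pdivrMl ?ltr0n //.
apply: (@le_trans _ _ (2 * (\sum_i \sum_j (G i j)%:R * v i ^+ 2 +
                       \sum_i \sum_j (G i j)%:R * v j ^+ 2))).
  rewrite -big_split mulr_sumr; apply: ler_sum => i _ /=.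
  rewrite -big_split mulr_sumr; apply: ler_sum => j _ /=.
  case: (G i j); rewrite ?mul0r ?mul1r ?addr0 ?mulr0 //.
  have ev : e ^+ 2 * v j ^+ 2 = v j ^+ 2 by rewrite e1 mul1r.
  have := sqr_ge0 (v i - e * v j); lra.
have : \sum_i deg R G i * v i ^+ 2 <= D%:R * \sum_i v i ^+ 2.
  rewrite mulr_sumr; apply: ler_sum => i _.
  by rewrite ler_wpM2r ?sqr_ge0 // ler_nat.
rewrite sum_adj_l sum_adj_r; lra.
Qed.

(** The form of [G] is at most that of the complete graph, which is [n] times
    the squared norm minus the square of the sum of the entries. *)
Lemma laplacian_eigval_le l :
  l \in eigvals (signed_laplacian G (-1)) -> l <= n%:R.
Proof.
move=> /eigvals_quadratic[|v v0]; first exact: slap_sym.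
rewrite slap_quadratic ?sqrrN ?expr1n // => vl; rewrite -(ler_pM2r v0) -vl.
rewrite ler_pdivrMl ?ltr0n //.
apply: (@le_trans _ _ (\sum_i \sum_j (v i - v j) ^+ 2)).
  apply: ler_sum => i _; apply: ler_sum => j _; rewrite mulN1r.
  by case: (G i j); rewrite ?mul1r ?mul0r ?sqr_ge0 ?lexx.
have -> : \sum_i \sum_j (v i - v j) ^+ 2 =
    2 * (n%:R * \sum_i v i ^+ 2) - 2 * (\sum_i v i) ^+ 2.
  have E1 : \sum_(i < n) \sum_(j < n) v i ^+ 2 = n%:R * \sum_i v i ^+ 2.
    rewrite mulr_sumr; apply: eq_bigr => i _.
    by rewrite sumr_const card_ord mulr_natl.
  have E2 : \sum_(i < n) \sum_(j < n) v j ^+ 2 = n%:R * \sum_i v i ^+ 2.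
    by rewrite exchange_big.
  have E3 : \sum_i \sum_j v i * v j = (\sum_i v i) ^+ 2.
    by rewrite expr2 mulr_suml; apply: eq_bigr => i _; rewrite mulr_sumr.
  rewrite mulr_natl mulr2n -{1}E1 -E2 -E3 mulr_sumr -big_split -sumrB.
  apply: eq_bigr => i _; rewrite mulr_sumr -big_split -sumrB.
  by apply: eq_bigr => j _; rewrite /=; ring.
have := sqr_ge0 (\sum_i v i); lra.
Qed.

Lemma sum_lambda (F : R -> R) e :
  \sum_(i < n) F (lambda (signed_laplacian G e) i) =
  \sum_(l <- eigvals (signed_laplacian G e)) F l.
Proof.
by rewrite [RHS](big_nth 0) size_eigvals ?slap_sym // big_mkord.
Qed.

(** The shift by 2 centres the spectrum of the path: all but two of its vertices
    have degree 2 and contribute little. *)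
Lemma shifted_power_sums e : e ^+ 2 = 1 ->
  [/\ \sum_(l <- eigvals (signed_laplacian G e)) (l - 2) =
        \sum_i (deg R G i - 2),
      \sum_(l <- eigvals (signed_laplacian G e)) (l - 2) ^+ 2 =
        \sum_i ((deg R G i - 2) ^+ 2 + deg R G i) &
      \sum_(l <- eigvals (signed_laplacian G e)) (l - 2) ^+ 3 =
        \sum_i ((deg R G i - 2) ^+ 3 + 3 * deg R G i * (deg R G i - 2))
        + e * triangles R G].
Proof.
move=> e1; pose s := eigvals (signed_laplacian G e).
have S0 : \sum_(l <- s) l ^+ 0 = \sum_(i < n) 1.
  rewrite big_const_seq count_predT size_eigvals ?slap_sym //.
  by rewrite big_const_ord.
have S1 : \sum_(l <- s) l = \sum_i deg R G i.
  by rewrite -(trace_slap1 G e) -sum_eigvals_pow ?slap_sym.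
have S2 := sum_eigvals_pow 2 (slap_sym G e).
have S3 := sum_eigvals_pow 3 (slap_sym G e).
rewrite trace_slap2 // in S2; rewrite trace_slap3 // in S3.
rewrite -/s in S2 S3 *; split.
(* The constants are multiplied by [l ^+ 0] for [big_split], which would break a
   bare numeral into a sum of ones. *)
- rewrite (eq_bigr (fun l => l + - 2 * l ^+ 0)) => [|l _]; last by ring.
  rewrite !big_split -mulr_sumr S0 S1 mulr_sumr -!big_split /=.
  by apply: eq_bigr => i _; ring.
- rewrite (eq_bigr (fun l => l ^+ 2 + (- 4 * l + 4 * l ^+ 0))) => [|l _].
    rewrite !big_split S2 -!mulr_sumr S0 S1 !mulr_sumr -!big_split /=.
    by apply: eq_bigr => i _; ring.
  by ring.
rewrite (eq_bigr (fun l => l ^+ 3 + (- 6 * l ^+ 2 + (12 * l + - 8 * l ^+ 0)))).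
  rewrite !big_split -!mulr_sumr S3 S2 S1 S0 !mulr_sumr /= addrAC.
  congr (_ + _); rewrite -!big_split /=.
  by apply: eq_bigr => i _; ring.
by move=> l _; ring.
Qed.

End Spectrum.

(** * Cubic bounds on the resolvent *)

Section Resolvent.
Variables (R : realType) (c : R) (s : seq R).
Let x := c - 2.
Let N : R := (size s)%:R.
Let t k := \sum_(l <- s) (l - 2) ^+ k.

(** The Taylor polynomial of degree 3 of [1 / (x - m)] at 0 leaves the remainder
    [m ^+ 4 / (x ^+ 4 * (x - m))].  The last term of the bound keeps part of it,
    through [4 * m ^+ 2 - 4 <= m ^+ 4] and [x - m <= x + 2]: without it the
    comparison fails for the star on 4 vertices. *)
Lemma resolvent_sum_ge : 0 < x -> (forall l, l \in s -> 0 <= l < c) ->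
  N / x + t 1 / x ^+ 2 + t 2 / x ^+ 3 + t 3 / x ^+ 4 +
    (4 * t 2 - 4 * N) / (x ^+ 4 * (x + 2)) <= \sum_(l <- s) 1 / (c - l).
Proof.
move=> x0 sc; pose p m := 1 / x + m / x ^+ 2 + m ^+ 2 / x ^+ 3 + m ^+ 3 / x ^+ 4
  + (4 * m ^+ 2 - 4) / (x ^+ 4 * (x + 2)).
have -> : N / x + t 1 / x ^+ 2 + t 2 / x ^+ 3 + t 3 / x ^+ 4 +
    (4 * t 2 - 4 * N) / (x ^+ 4 * (x + 2)) = \sum_(l <- s) p (l - 2).
  have -> : N = \sum_(l <- s) 1.
    by rewrite big_const_seq count_predT -Monoid.iteropE.
  rewrite /t /p !mulr_sumr -sumrB !mulr_suml -!big_split /=.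
  by apply: eq_bigr => l _; rewrite expr1 mulr1.
rewrite !big_seq; apply: ler_sum => l /sc/andP[l0 lc].
have xl : 0 < x - (l - 2) by rewrite /x; lra.
have -> : c - l = x - (l - 2) by rewrite /x; ring.
have : -2 <= l - 2 by lra.
move: (l - 2) xl => m xm m2.
have x2 : 0 < x + 2 by lra.
rewrite -subr_ge0.
have -> : 1 / (x - m) - p m = 
   (m ^+ 4 * (x + 2) - (4 * m ^+ 2 - 4) * (x - m)) /
   (x ^+ 4 * (x + 2) * (x - m)).
  by rewrite /p; field; rewrite !gt_eqF.
rewrite divr_ge0 ?mulr_ge0 ?exprn_ge0 //; try exact: ltW.
have : 0 <= (m ^+ 2 - 2) ^+ 2 * (x - m) by rewrite mulr_ge0 ?sqr_ge0 // ltW.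
have : 0 <= m ^+ 4 * (m + 2) by rewrite mulr_ge0 ?exprn_even_ge0 //; lra.
lra.
Qed.

(** Keep the Taylor polynomial of degree 1 and bound the factor [1 / (x - m)]
    of its remainder [m ^+ 2 / (x ^+ 2 * (x - m))] by the chord between [-2]
    and [b]. *)
Lemma resolvent_sum_le b : 0 < x -> b < x ->
  (forall l, l \in s -> 0 <= l <= b + 2) ->
  \sum_(l <- s) 1 / (c - l) <= N / x + t 1 / x ^+ 2 +
    ((x + 2 - b) * t 2 + t 3) / (x ^+ 2 * (x + 2) * (x - b)).
Proof.
move=> x0 bx sb; pose p m := 1 / x + m / x ^+ 2 +
  ((x + 2 - b) * m ^+ 2 + m ^+ 3) / (x ^+ 2 * (x + 2) * (x - b)).
have -> : N / x + t 1 / x ^+ 2 + ((x + 2 - b) * t 2 + t 3) /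
   (x ^+ 2 * (x + 2) * (x - b)) = \sum_(l <- s) p (l - 2).
  have -> : N = \sum_(l <- s) 1.
    by rewrite big_const_seq count_predT -Monoid.iteropE.
  rewrite /t /p !mulr_sumr -!big_split !mulr_suml -!big_split /=.
  by apply: eq_bigr => l _; rewrite expr1.
rewrite !big_seq; apply: ler_sum => l /sb/andP[l0 lc].
have xl : 0 < x - (l - 2) by lra.
have -> : c - l = x - (l - 2) by rewrite /x; ring.
have : -2 <= l - 2 <= b by lra.
move: (l - 2) xl => m xm m2.
have x2 : 0 < x + 2 by lra.
have xb : 0 < x - b by lra.
rewrite -subr_ge0.
have -> : p m - 1 / (x - m) =
   (m ^+ 2 * ((m + 2) * (b - m))) / (x ^+ 2 * (x + 2) * (x - b) * (x - m)).
  by rewrite /p; field; rewrite !gt_eqF.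
apply: divr_ge0.
  by rewrite mulr_ge0 ?sqr_ge0 // mulr_ge0; lra.
by rewrite !mulr_ge0 ?sqr_ge0; lra.
Qed.

End Resolvent.

(** In the two estimates below [N] is the number of vertices and the left-hand
    side is the cubic bound for the path, the common terms being removed. The
    worst case of the constraint on [N] is [N = x + 1]; the resulting
    polynomial in [x] has nonnegative coefficients in powers of [x - 3]. *)
Lemma tree_estimate (R : realType) (x N t2 t3 : R) :
  3 <= x -> N <= x + 1 -> 2 * N + 2 <= t2 -> 3 * t2 - 6 * N - 8 <= t3 ->
  (x * (2 * N) - 8) / (x ^+ 2 * (x + 2) * (x - 2)) <=
  t2 / x ^+ 3 + t3 / x ^+ 4 + (4 * t2 - 4 * N) / (x ^+ 4 * (x + 2)).
Proof.
move=> x3 Nx t2N t3N; rewrite -subr_ge0.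
have -> : t2 / x ^+ 3 + t3 / x ^+ 4 + (4 * t2 - 4 * N) / (x ^+ 4 * (x + 2)) -
  (x * (2 * N) - 8) / (x ^+ 2 * (x + 2) * (x - 2)) =
  ((t2 * x + t3) * (x ^+ 2 - 4) + (4 * t2 - 4 * N) * (x - 2)
    - (2 * N * x - 8) * x ^+ 2) / (x ^+ 4 * (x + 2) * (x - 2)).
  by field; rewrite !gt_eqF //; lra.
have x24 : 0 <= x ^+ 2 - 4 by nra.
apply: divr_ge0; last by rewrite !mulr_ge0 ?exprn_ge0; lra.
have A : 0 <= (t3 - (3 * t2 - 6 * N - 8)) * (x ^+ 2 - 4).
  by rewrite mulr_ge0; lra.
have B : 0 <= (t2 - (2 * N + 2)) * ((x + 3) * (x ^+ 2 - 4) + 4 * (x - 2)).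
  apply: mulr_ge0; first by lra.
  by apply: addr_ge0; apply: mulr_ge0; lra.
have C : 0 <= (x + 1 - N) * (4 * x + 8) by rewrite mulr_ge0; lra.
have D : 0 <= 2 * x ^+ 3 + 2 * x ^+ 2 - 12 * x - 16.
  have -> : 2 * x ^+ 3 + 2 * x ^+ 2 - 12 * x - 16 =
    2 * (x - 3) ^+ 3 + 20 * (x - 3) ^+ 2 + 54 * (x - 3) + 20 by ring.
  have : 0 <= x - 3 by lra.
  by move: (x - 3) => y y0; rewrite !addr_ge0 ?mulr_ge0 ?exprn_ge0.
lra.
Qed.

Lemma cyclic_estimate (R : realType) (x N t1 t2 t3 : R) :
  3 <= x -> N <= x + 1 -> 0 <= t1 -> 2 * N <= t2 -> - 2 * N <= t3 ->
  -2 / x ^+ 2 + (x * (2 * N) - 8) / (x ^+ 2 * (x + 2) * (x - 2)) <=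
  t1 / x ^+ 2 + t2 / x ^+ 3 + t3 / x ^+ 4.
Proof.
move=> x3 Nx t1N t2N t3N; rewrite -subr_ge0.
have -> : t1 / x ^+ 2 + t2 / x ^+ 3 + t3 / x ^+ 4 -
  (-2 / x ^+ 2 + (x * (2 * N) - 8) / (x ^+ 2 * (x + 2) * (x - 2))) =
  (((t1 + 2) * x ^+ 2 + t2 * x + t3) * (x ^+ 2 - 4)
    - (2 * N * x - 8) * x ^+ 2) / (x ^+ 4 * (x + 2) * (x - 2)).
  by field; rewrite !gt_eqF //; lra.
have x24 : 0 <= x ^+ 2 - 4 by nra.
apply: divr_ge0; last by rewrite !mulr_ge0 ?exprn_ge0; lra.
have A : 0 <= (t1 * x ^+ 2 + (t2 - 2 * N) * x + (t3 + 2 * N)) * (x ^+ 2 - 4).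
  apply: mulr_ge0 => //; apply: addr_ge0; last by lra.
  by apply: addr_ge0; apply: mulr_ge0; rewrite ?exprn_ge0; lra.
have C : 0 <= (x + 1 - N) * (2 * x ^+ 2 + 8 * x - 8).
  by rewrite mulr_ge0; nra.
have D : 0 <= 2 * x ^+ 4 - 2 * x ^+ 3 - 10 * x ^+ 2 + 8.
  have -> : 2 * x ^+ 4 - 2 * x ^+ 3 - 10 * x ^+ 2 + 8 =
    2 * (x - 3) ^+ 4 + 22 * (x - 3) ^+ 3 + 80 * (x - 3) ^+ 2
     + 102 * (x - 3) + 26 by ring.
  have : 0 <= x - 3 by lra.
  by move: (x - 3) => y y0; rewrite !addr_ge0 ?mulr_ge0 ?exprn_ge0.
lra.
Qed.

(** * Degree sums of connected graphs *)

Section Connected.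
Variables (n : nat) (G : sgraph n).
Local Open Scope nat_scope.
Implicit Type S : {set 'I_n}.

Definition inner S := \sum_(i in S) \sum_(j in S) G i j.

Definition degsum := \sum_i degree G i.

Lemma inner_setT : inner setT = degsum.
Proof.
apply: eq_big => [i|i _]; rewrite ?inE // degreeE.
by apply: eq_bigl => j; rewrite inE.
Qed.

Lemma inner_setU1 S y : y \notin S ->
  inner (y |: S) = inner S + 2 * \sum_(x in S) G x y.
Proof.
move=> yS; rewrite /inner big_setU1 //= big_setU1 //= adj_irr add0n.
under eq_bigr => x _ do rewrite adj_sym.
rewrite [X in _ + X](eq_bigr (fun i => G i y + \sum_(j in S) G i j)).
  by rewrite big_split /= addnA addnC mul2n -addnn.
by move=> i _; rewrite big_setU1.
Qed.

Hypothesis Gconn : connected_graph G.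

Lemma boundary_edge S : S != set0 -> S != setT ->
  exists2 y, y \notin S & exists2 x, x \in S & G x y.
Proof.
move=> /set0Pn[a aS]; rewrite -subTset => /subsetPn[b _ bS].
case: (boolP [exists y, (y \notin S) && [exists x, (x \in S) && G x y]]).
  case/existsP => y /andP[yS /existsP[x /andP[xS xy]]].
  by exists y => //; exists x.
move=> nE; suff /closed_connect cl : closed G (mem S).
  by have := cl a b (Gconn a b); rewrite /= aS (negPf bS).
apply: intro_closed; first exact: sym_connect_sym (@adj_sym _ G).
move=> x y xy xS; apply: contraR nE => yS; apply/existsP; exists y.
by rewrite yS; apply/existsP; exists x; rewrite xS.
Qed.

(** Growing [S] by one vertex along a boundary edge adds 2 to [2 * #|S|] and
    at least 2 to [inner S]. Started from a vertex this gives the bound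
    [n - 1] on the number of edges, started from a triangle the bound [n]. *)
Lemma degsum_ge_inner S k : S != set0 -> 2 * #|S| + k <= inner S + 2 ->
  2 * n + k <= degsum + 2.
Proof.
elim: {S}_.+1 {-2}S (ltnSn #|~: S|) => // m IH S Sm S0 Sk.
have [ST|SnT] := eqVneq S setT.
  by move: Sk; rewrite ST inner_setT cardsT card_ord.
have [y yS [x xS xy]] := boundary_edge S0 SnT.
apply: (IH (y |: S)).
- rewrite -ltnS; apply: leq_trans Sm; rewrite ltnS setCU setIC -setDE.
  by rewrite [in X in _ <= X](cardsD1 y (~: S)) inE yS.
- by apply/set0Pn; exists y; rewrite setU11.
rewrite inner_setU1 // cardsU1 yS (bigD1 x) //= xy.
by move: (\sum_(i in S | i != x) G i y) (inner S) #|S| Sk => z a q; lia.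
Qed.

Lemma degsum_ge : 0 < n -> 2 * n <= degsum + 2.
Proof.
move=> n0; rewrite -[2 * n]addn0.
apply: (@degsum_ge_inner [set Ordinal n0]).
  by apply/set0Pn; exists (Ordinal n0); rewrite set11.
by rewrite cards1 addn0 leq_addl.
Qed.

Lemma triangle_degsum i j k : G i j -> G j k -> G k i -> 2 * n <= degsum.
Proof.
move=> ij jk ki; rewrite -(leq_add2r 2).
have nij : i != j by apply: contraTneq ij => ->; rewrite adj_irr.
have njk : j != k by apply: contraTneq jk => ->; rewrite adj_irr.
have nki : k != i by apply: contraTneq ki => ->; rewrite adj_irr.
apply: (@degsum_ge_inner (i |: (j |: [set k]))).
  by apply/set0Pn; exists i; rewrite setU11.
have iS : i \notin j |: [set k] by rewrite !inE negb_or nij eq_sym.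
have jS : j \notin [set k] by rewrite inE.
rewrite inner_setU1 // inner_setU1 // !cardsU1 iS jS cards1.
rewrite big_setU1 //= !big_set1 [G k j]adj_sym [G j i]adj_sym ij jk ki; lia.
Qed.

Lemma degree_gt0 i : 1 < n -> 0 < degree G i.
Proof.
move=> n1; have [||y _ [x]] := @boundary_edge [set i].
- by apply/set0Pn; exists i; rewrite set11.
- by apply: contraTneq n1 => iT; rewrite -[n]card_ord -cardsT -iT cards1.
rewrite inE => /eqP-> iy; rewrite /degree; apply/card_gt0P; exists y.
by rewrite inE.
Qed.

End Connected.

Lemma degsum_even n (G : sgraph n) : ~~ odd (degsum G).
Proof.
suff -> : degsum G = ((\sum_(i < n) \sum_(j < n | (i < j)%N) G i j).*2)%N.
  by rewrite odd_double.
rewrite -addnn [X in (_ + X)%N](exchange_big_dep xpredT) //= -big_split.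
apply: eq_bigr => i _ /=; rewrite degreeE.
rewrite (bigID (fun j : 'I_n => (i < j)%N)) /=; congr (_ + _)%N.
rewrite (bigID (fun j : 'I_n => (j < i)%N)) /= [X in (_ + X)%N]big1 ?addn0.
  apply: eq_big => [j|j _]; last by rewrite adj_sym.
  by case: ltngtP.
move=> j /andP[]; rewrite -!leqNgt => ji ij.
have -> : j = i by apply/val_inj/eqP; rewrite eqn_leq ji ij.
by rewrite adj_irr.
Qed.

Lemma degree_lt n (G : sgraph n) i : (degree G i < n)%N.
Proof.
rewrite -[n in (_ < n)%N]card_ord -cardsT; apply: proper_card.
rewrite properEneq subsetT andbT; apply/eqP => /setP/(_ i).
by rewrite !inE adj_irr.
Qed.

(** * The path graph *)

Lemma path_connected n : connected_graph (path_graph n).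
Proof.
move=> x y; have csym := sym_connect_sym (@adj_sym _ (path_graph n)).
have to0 k (kn : (k < n)%N) (n0 : (0 < n)%N) :
  connect (path_graph n) (Ordinal kn) (Ordinal n0).
  elim: k kn => [|k IH] kn.
    by rewrite (_ : Ordinal kn = Ordinal n0) ?connect0 //; apply: val_inj.
  apply: connect_trans (IH (ltnW kn)); apply: connect1.
  by apply/orP; right; apply/eqP.
have n0 : (0 < n)%N by case: (n) x => // -[].
case: x y => [x xn] [y yn].
by apply: connect_trans (to0 x xn n0) _; rewrite csym.
Qed.

Lemma sum_eq_val n (a : nat) : (\sum_(j < n) (a == j) = (a < n))%N.
Proof.
have [an|na] := ltnP.
  rewrite (bigD1 (Ordinal an)) //= eqxx big1 // => j.
  by rewrite -val_eqE /= eq_sym => /negPf->.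
by rewrite big1 // => j _; rewrite gtn_eqF // (leq_trans _ na).
Qed.

Lemma path_degree_le2 n i : (degree (path_graph n) i <= 2)%N.
Proof.
rewrite degreeE /=.
apply: (@leq_trans (\sum_(j < n) (i.+1 == j) + \sum_(j < n) (i.-1 == j))%N).
  rewrite -big_split; apply: leq_sum => j _ /=.
  rewrite /path_rel /=; case: (j.+1 =P i :> nat) => [<-|_] /=.
    by rewrite eqxx orbT leq_addl.
  by rewrite orbF leq_addr.
by rewrite !sum_eq_val; do 2!case: (_ < _)%N.
Qed.

Lemma path_degsum_le n : (0 < n)%N -> (degsum (path_graph n) + 2 <= 2 * n)%N.
Proof.
case: n => // n _; rewrite /degsum.
apply: (@leq_trans (\sum_(i < n.+1) \sum_(j < n.+1) (i.+1 == j)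
                  + \sum_(i < n.+1) \sum_(j < n.+1) (j.+1 == i) + 2)%N).
  rewrite leq_add2r -big_split; apply: leq_sum => i _ /=.
  rewrite degreeE -big_split; apply: leq_sum => j _ /=.
  by rewrite /path_rel /=; do 2!case: eqP.
rewrite [X in (_ + X + _)%N]exchange_big /=.
rewrite addnn -mul2n -{2}[2%N]muln1 -mulnDr leq_mul2l /=.
rewrite (eq_bigr (fun i : 'I_n.+1 => (i < n)%N : nat)) => [|i _].
  rewrite big_ord_recr /= ltnn addn0.
  rewrite (eq_bigr (fun=> 1%N)) => [|i _]; last by rewrite ltn_ord.
  by rewrite sum1_card card_ord addn1.
by rewrite sum_eq_val ltnS.
Qed.

(** * Connected graphs of maximum degree two *)

Section HamiltonianPath.
Variables (n : nat) (G : sgraph n).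
Hypotheses (Gconn : connected_graph G) (Gdeg : forall i, (degree G i <= 2)%N).

Lemma longest_path : (0 < n)%N -> exists s : seq 'I_n,
  [/\ (0 < size s)%N, uniq s, sorted G s &
      forall t, uniq t -> sorted G t -> (size t <= size s)%N].
Proof.
move=> n0; pose P k := [exists t : k.-tuple 'I_n, uniq t && sorted G t].
have P1 : P 1%N.
  by apply/existsP; exists [tuple of [:: Ordinal n0]].
have Pn k : P k -> (k <= n)%N.
  case/existsP => t /andP[/card_uniqP tu _].
  by rewrite -{1}(size_tuple t) -tu -[n in (_ <= n)%N]card_ord max_card.
case: (ex_maxnP (ex_intro P 1%N P1) Pn) => k Pk kmax.
case/existsP: Pk => s /andP[su ss]; exists s; split=> //.
  by rewrite size_tuple kmax.
move=> t tu ts; rewrite size_tuple; apply: kmax; apply/existsP.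
by exists (in_tuple t); rewrite tu ts.
Qed.

Lemma degree_ge3 w a b z : G w a -> G w b -> G w z -> uniq [:: a; b; z] ->
  (2 < degree G w)%N.
Proof.
move=> wa wb wz u; rewrite /degree cardE; apply: (uniq_leq_size u) => y.
by rewrite !inE mem_enum inE => /or3P[] /eqP->.
Qed.

(** An end vertex with a neighbour outside would give a longer path; an inner
    vertex already has its two neighbours on the path. *)
Lemma longest_path_closed s w z :
  uniq s -> sorted G s ->
  (forall t, uniq t -> sorted G t -> (size t <= size s)%N) ->
  G w z -> w \in s -> z \in s.
Proof.
move=> us ss smax wz ws; apply/negPn/negP => zs.
case/splitPr: ws us ss smax zs => p1 p2 us ss smax zs.
have zu : uniq (z :: p1 ++ w :: p2) by rewrite /= zs.
case/lastP: p1 us ss smax zs zu => [|p1 a] us ss smax zs zu.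
  have : sorted G (z :: w :: p2) by rewrite /= adj_sym wz.
  by move/(smax _ zu); rewrite /= ltnn.
case: p2 us ss smax zs zu => [|b p2] us ss smax zs zu.
  have := smax (rcons (rcons p1 a ++ [:: w]) z).
  rewrite rcons_uniq zs us size_rcons ltnn => /(_ isT) H.
  suff : false by []; apply: H; move: ss; rewrite !cats1.
  case: (p1) => [|c p] /=; last by rewrite !rcons_path !last_rcons wz andbT.
  by rewrite wz !andbT.
have wb : G w b.
  move: ss; case: (p1) => [|c p] /=; rewrite ?cat_path /= ?last_rcons.
    by case/and3P.
  by case/and4P.
have wa : G w a.
  rewrite adj_sym.
  move: ss; case: (p1) => [|c p] /=; rewrite ?cat_path /= ?last_rcons.
    by case/and3P.
  by case/and4P.
have := Gdeg w; rewrite leqNgt (degree_ge3 wa wb wz) //.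
have ab : a != b.
  apply: contraTneq us => ->.
  by rewrite cat_uniq /= !mem_rcons !inE eqxx !orbT /= andbF.
have az : a != z.
  by apply: contraNneq zs => <-; rewrite mem_cat mem_rcons mem_head.
have bz : b != z by apply: contraNneq zs => <-; rewrite mem_cat !inE eqxx !orbT.
by rewrite /= !inE negb_or ab az bz.
Qed.

Lemma hamiltonian_path : (0 < n)%N ->
  exists2 f : 'I_n -> 'I_n, injective f &
    forall i j : 'I_n, i.+1 = j -> G (f i) (f j).
Proof.
move=> n0; have [s [s0 us ss smax]] := longest_path n0.
have sall y : y \in s.
  have cl : closed G (mem s).
    apply: intro_closed; first exact: sym_connect_sym (@adj_sym _ G).
    by move=> x z xz; apply: longest_path_closed.
  case: s s0 {us ss smax} cl => // x s _ cl.
  by rewrite -(closed_connect cl (Gconn x y)) /= mem_head.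
have sn : size s = n.
  by rewrite -(card_uniqP us) -[RHS]card_ord; apply: eq_card => y; rewrite sall.
exists (fun i => nth i s i) => [i j|i j ij].
  rewrite (set_nth_default j) ?sn // => /eqP.
  by rewrite nth_uniq ?sn // => /eqP /val_inj.
rewrite [nth j s j](set_nth_default i) ?sn // -ij.
by move/(sortedP i): ss; apply; rewrite sn ij.
Qed.

(** The path embeds into [G] along a Hamiltonian path, and the degree sums
    leave no room for further edges. *)
Lemma path_iso : (0 < n)%N -> (degsum G + 2 <= 2 * n)%N ->
  exists s : 'S_n, forall i j, G (s i) (s j) = path_graph n i j.
Proof.
move=> n0 Gn; have [f finj fG] := hamiltonian_path n0.
exists (perm finj) => i j; rewrite !permE.
have le (p : 'I_n * 'I_n) : true -> (path_graph n p.1 p.2 <=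
    G (f p.1) (f p.2) ?= iff (path_graph n p.1 p.2 == G (f p.1) (f p.2)))%N.
  move=> _; split; last by case: (path_graph _ _ _); case: (G _ _).
  case E : (path_graph n p.1 p.2) => //; case/orP: E => /eqP E.
    by rewrite fG.
  by rewrite adj_sym fG.
have [_ /esym] := leqif_sum le.
suff -> : (\sum_p path_graph n p.1 p.2 == \sum_p G (f p.1) (f p.2))%N.
  by move/forallP/(_ (i, j))/eqP => /= ->.
rewrite eqn_leq (leqif_sum le) /=.
rewrite -(pair_bigA _ (fun i j => path_graph n i j : nat)).
rewrite -(pair_bigA _ (fun i j => G (f i) (f j) : nat)) /=.
apply: (@leq_trans (degsum G)).
  rewrite /degsum [X in (_ <= X)%N](reindex_inj finj); apply: leq_sum => k _.
  by rewrite degreeE [X in (_ <= X)%N](reindex_inj finj).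
rewrite -(leq_add2r 2) (leq_trans Gn) //.
rewrite (leq_trans (degsum_ge (@path_connected n) n0)) //.
by rewrite leq_add2r; apply: leq_sum => k _; rewrite degreeE.
Qed.

End HamiltonianPath.

Lemma eigvals_slap_iso (R : realType) n (G H : sgraph n) (s : 'S_n) (e : R) :
  (forall i j, G (s i) (s j) = H i j) ->
  eigvals (signed_laplacian G e) = eigvals (signed_laplacian H e).
Proof.
move=> GH.
suff E : signed_laplacian H e = row_perm s (col_perm s (signed_laplacian G e)).
  have cE : char_poly (signed_laplacian H e) = char_poly (signed_laplacian G e).
    have -> : signed_laplacian H e =
        invmx (perm_mx s^-1%g) *m signed_laplacian G e *m perm_mx s^-1%g.
      rewrite E row_permE col_permE mulmxA; congr (_ *m _ *m _).
      rewrite -[LHS]mul1mx -(mulVmx (unitmx_perm _ s^-1%g)) -mulmxA -perm_mxM.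
      by rewrite mulVg perm_mx1 mulmx1.
    by rewrite char_poly_conj ?unitmx_perm.
  by rewrite /eigvals cE.
apply/matrixP => i j; rewrite !mxE GH (inj_eq perm_inj); congr (_ *+ _ + _).
congr (_%:R); rewrite !degreeE [RHS](reindex_inj (@perm_inj _ s)).
by apply: eq_bigr => k _; rewrite GH.
Qed.

(** * Moments of the shifted spectra *)

Section Moments.
Variables (R : realType) (n : nat) (G : sgraph n) (e : R).
Hypotheses (Gconn : connected_graph G) (n1 : (1 < n)%N) (e1 : e ^+ 2 = 1).
Let N : R := n%:R.
Let d i : R := deg R G i.
Let t k := \sum_(l <- eigvals (signed_laplacian G e)) (l - 2) ^+ k.

Lemma sum_deg : \sum_i d i = (degsum G)%:R.
Proof. by rewrite natr_sum. Qed.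

Lemma sum_affine (a b : R) : \sum_i (a * d i + b) = a * (degsum G)%:R + b * N.
Proof.
rewrite big_split -mulr_sumr sum_deg sumr_const card_ord /=.
by rewrite -[b *+ n]mulr_natr.
Qed.

Lemma sum_two : \sum_(i < n) 2 = 2 * N.
Proof. by rewrite sumr_const card_ord -[2 *+ n]mulr_natr. Qed.

Lemma moment1 : t 1 = (degsum G)%:R - 2 * N.
Proof.
have [t1 _ _] := shifted_power_sums G e1.
rewrite /t (eq_bigr (fun l => l - 2)) => [|l _]; last by rewrite expr1.
rewrite t1 -[X in X - _]mul1r -mulNr -sum_affine.
by apply: eq_bigr => i _; rewrite mul1r.
Qed.

Lemma deg_cases i : [\/ d i = 1, d i = 2 | 3 <= d i].
Proof.
have := degree_gt0 Gconn i n1; rewrite /d /deg.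
case: (degree G i) => [|[|[|k]]] // _; [exact: Or31|exact: Or32|apply: Or33].
by rewrite ler_nat.
Qed.

Lemma triangles_eq0 : (degsum G < 2 * n)%N -> triangles R G = 0.
Proof.
move=> Gn; apply: big1 => i _; apply: big1 => j _; apply: big1 => k _.
case ij: (G i j); case jk: (G j k); case ki: (G k i) => //.
by move: Gn; rewrite ltnNge (triangle_degsum Gconn ij jk ki).
Qed.

Lemma moment1_tree : (degsum G + 2 = 2 * n)%N -> t 1 = -2.
Proof.
by move=> /(congr1 (fun k => k%:R : R)); rewrite natrD natrM moment1; lra.
Qed.

Lemma moment3_tree : (degsum G + 2 = 2 * n)%N ->
  t 3 = \sum_i ((d i - 2) ^+ 3 + 3 * d i * (d i - 2)).
Proof.
move=> Gn; have [_ _ t3] := shifted_power_sums G e1.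
by rewrite /t t3 triangles_eq0 ?mulr0 ?addr0 // -Gn -addn1 leq_add2l.
Qed.

(** On the degrees 1 and 2 the polynomials of the second and third moments
    agree with the affine ones [2] and [4 * d - 8]. *)
Lemma moments_path : (degsum G + 2 = 2 * n)%N ->
  (forall i, (degree G i <= 2)%N) ->
  [/\ t 1 = -2, t 2 = 2 * N & t 3 = -8].
Proof.
move=> Gn G2; have [_ t2 _] := shifted_power_sums G e1.
have d12 i : d i = 1 \/ d i = 2.
  have [->|->|] := deg_cases i; [by left|by right|].
  by rewrite ler_nat leqNgt ltnS G2.
split; first exact: moment1_tree.
  rewrite /t t2 -sum_two.
  by apply: eq_bigr => i _; rewrite -/(d i); case: (d12 i) => ->; ring.
have -> : -8 = 4 * (degsum G)%:R + - 8 * N :> R.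
  by move/(congr1 (fun k => k%:R : R)): Gn; rewrite natrD natrM /N; lra.
rewrite moment3_tree // -sum_affine.
by apply: eq_bigr => i _; case: (d12 i) => ->; ring.
Qed.

(** The second moment exceeds [2 * N] by the sum of [(d - 1) * (d - 2)], to
    which a vertex of degree at least 3 contributes at least 2. *)
Lemma moments_tree : (degsum G + 2 = 2 * n)%N ->
  (exists i, (2 < degree G i)%N) ->
  [/\ t 1 = -2, 2 * N + 2 <= t 2 & 3 * t 2 - 6 * N - 8 <= t 3].
Proof.
move=> Gn [i0 Gi0]; have [_ t2 _] := shifted_power_sums G e1.
have t2E : t 2 = \sum_i (d i - 1) * (d i - 2) + 2 * N.
  rewrite -sum_two -big_split /t t2.
  by apply: eq_bigr => i _; rewrite -/(d i) /=; ring.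
have d0 i : 0 <= (d i - 1) * (d i - 2) by case: (deg_cases i) => [->|->|h]; nra.
split; first exact: moment1_tree.
  rewrite t2E (bigD1 i0) //=.
  have : 3 <= d i0 by rewrite ler_nat.
  have : 0 <= \sum_(i | i != i0) (d i - 1) * (d i - 2) by apply: sumr_ge0.
  by nra.
have -> : 3 * t 2 - 6 * N - 8 = 3 * \sum_i (d i - 1) * (d i - 2) +
    (4 * (degsum G)%:R + - 8 * N).
  by move/(congr1 (fun k => k%:R : R)): Gn; rewrite t2E natrD natrM /N; lra.
rewrite moment3_tree // -sum_affine mulr_sumr -big_split; apply: ler_sum => i _.
rewrite /= -subr_ge0.
have -> : (d i - 2) ^+ 3 + 3 * d i * (d i - 2) -
  (3 * ((d i - 1) * (d i - 2)) + (4 * d i + -8)) =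
  ((d i - 1) * (d i - 2)) * (d i - 3) by ring.
clear Gn; case: (deg_cases i) (d0 i) => [->|->|h] h0; try by lra.
by rewrite mulr_ge0; lra.
Qed.

(** For the third moment, the triangles are bounded by the sum of
    [d ^+ 2 - d], and what is left is at least [2 * d - 6] at each vertex. *)
Lemma moments_cyclic : (2 * n <= degsum G)%N ->
  [/\ 0 <= t 1, 2 * N <= t 2 & - 2 * N <= t 3].
Proof.
rewrite -(ler_nat R) natrM => Gn; have [_ t2 t3] := shifted_power_sums G e1.
split; first by rewrite moment1 /N; lra.
  rewrite -sum_two /t t2.
  apply: ler_sum => i _; rewrite -/(d i).
  by case: (deg_cases i) => [->|->|h]; nra.
have eT : - triangles R G <= e * triangles R G.
  have e_1 : 0 <= e + 1.
    by have := sqr_ge0 (e + 1); rewrite sqrrD e1 expr1n mulr1; lra.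
  by have := mulr_ge0 e_1 (triangles_ge0 R G); lra.
rewrite /t t3; apply: le_trans (lerD (lexx _) eT).
apply: le_trans (lerB (lexx _) (triangles_le R G)); rewrite -sumrB.
apply: (@le_trans _ _ (2 * (degsum G)%:R + - 6 * N)); first by rewrite /N; lra.
rewrite -sum_affine; apply: ler_sum => i _; rewrite -/(d i) -subr_ge0.
have -> : (d i - 2) ^+ 3 + 3 * d i * (d i - 2) - (d i ^+ 2 - d i) -
  (2 * d i + -6) = (d i - 1) ^+ 2 * (d i - 2) by ring.
by case: (deg_cases i) => [->|->|h]; [lra|lra|rewrite mulr_ge0 ?sqr_ge0; lra].
Qed.

End Moments.

(** * Comparison with the path *)

Section Comparison.
Variables (R : realType) (n : nat) (G : sgraph n) (e c : R).
Hypotheses (Gconn : connected_graph G) (n3 : (2 < n)%N) (e1 : e ^+ 2 = 1).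
Hypothesis Gc : forall l, l \in eigvals (signed_laplacian G e) -> l < c.
Let res (H : sgraph n) :=
  \sum_(l <- eigvals (signed_laplacian H e)) 1 / (c - l).

Lemma path_degsum m : (0 < m)%N -> (degsum (path_graph m) + 2 = 2 * m)%N.
Proof.
move=> m0; apply/eqP; rewrite eqn_leq path_degsum_le //.
exact: degsum_ge (@path_connected m) m0.
Qed.

Lemma path_resolvent_le b : 0 < c - 2 -> b < c - 2 ->
  (forall l, l \in eigvals (signed_laplacian (path_graph n) e) -> l <= b + 2) ->
  res (path_graph n) <= n%:R / (c - 2) - 2 / (c - 2) ^+ 2 +
    ((c - 2 + 2 - b) * (2 * n%:R) - 8) /
      ((c - 2) ^+ 2 * (c - 2 + 2) * (c - 2 - b)).
Proof.
move=> c0 bc lb.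
have [t1 t2 t3] := moments_path (@path_connected n) (ltnW n3) e1
  (path_degsum (ltnW (ltnW n3))) (@path_degree_le2 n).
have := resolvent_sum_le c0 bc
  (s := eigvals (signed_laplacian (path_graph n) e)).
rewrite t1 t2 t3 size_eigvals ?slap_sym // mulNr; apply=> l ll.
by rewrite (slap_eigval_ge0 e1 ll) lb.
Qed.

Let t k := \sum_(l <- eigvals (signed_laplacian G e)) (l - 2) ^+ k.

Lemma resolvent_ge : 0 < c - 2 ->
  n%:R / (c - 2) + t 1 / (c - 2) ^+ 2 + t 2 / (c - 2) ^+ 3 +
    t 3 / (c - 2) ^+ 4 +
    (4 * t 2 - 4 * n%:R) / ((c - 2) ^+ 4 * (c - 2 + 2)) <= res G.
Proof.
move=> c0.
have := resolvent_sum_ge c0 (s := eigvals (signed_laplacian G e)).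
rewrite size_eigvals ?slap_sym //; apply=> l ll.
by rewrite (slap_eigval_ge0 e1 ll) Gc.
Qed.

Lemma path_eigval_le4 l :
  l \in eigvals (signed_laplacian (path_graph n) e) -> l <= 2 + 2.
Proof.
by move/(slap_eigval_le e1 (@path_degree_le2 n)); lra.
Qed.

Lemma resolvent_path_le_tree : 5 <= c -> n%:R + 1 <= c ->
  (degsum G + 2 = 2 * n)%N -> (exists i, (2 < degree G i)%N) ->
  res (path_graph n) <= res G.
Proof.
move=> c5 nc Gn G3.
have [] := moments_tree Gconn (ltnW n3) e1 Gn G3.
rewrite -/(t 1) -/(t 2) -/(t 3) => t1 t2 t3.
clear Gn.
have x3 : 3 <= c - 2 by lra.
have Nx : n%:R <= c - 2 + 1 by lra.
have := tree_estimate x3 Nx t2 t3.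
have x0 : 0 < c - 2 by lra.
have x2 : 2 < c - 2 by lra.
have := path_resolvent_le x0 x2 path_eigval_le4.
have := resolvent_ge x0; rewrite t1 addrK mulNr; lra.
Qed.

Lemma resolvent_path_le_cyclic : 5 <= c -> n%:R + 1 <= c ->
  (2 * n <= degsum G)%N -> res (path_graph n) <= res G.
Proof.
move=> c5 nc Gn.
have [] := moments_cyclic Gconn (ltnW n3) e1 Gn.
rewrite -/(t 1) -/(t 2) -/(t 3) => t1 t2 t3.
have x3 : 3 <= c - 2 by lra.
have Nx : n%:R <= c - 2 + 1 by lra.
have := cyclic_estimate x3 Nx t1 t2 t3.
have x0 : 0 < c - 2 by lra.
have x2 : 2 < c - 2 by lra.
have := path_resolvent_le x0 x2 path_eigval_le4.
have := resolvent_ge x0; rewrite mulNr.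
have : 0 <= (4 * t 2 - 4 * n%:R) / ((c - 2) ^+ 4 * (c - 2 + 2)).
  have n0 : 0 <= n%:R :> R by [].
  by apply: divr_ge0; rewrite ?mulr_ge0 ?exprn_ge0; lra.
by rewrite addrK; lra.
Qed.

End Comparison.

(** The one case with [x = 2], where the interval [[-2, 2]] would reach the
    pole; on 3 vertices the shifted Laplacian spectrum of the path lies in
    [[-2, 1]]. *)
Lemma laplacian_resolvent_3 (R : realType) (G : sgraph 3) :
  connected_graph G -> (2 * 3 <= degsum G)%N ->
  \sum_(l <- eigvals (signed_laplacian (path_graph 3) (-1))) 1 / (4 - l) <=
  \sum_(l <- eigvals (signed_laplacian G (-1))) 1 / (4 - l) :> R.
Proof.
move=> Gconn Gn; have e1 : (-1) ^+ 2 = 1 :> R by rewrite sqrrN expr1n.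
have c0 : 0 < 4 - 2 :> R by lra.
have b1 : 1 < 4 - 2 :> R by lra.
have [t1 t2 t3] := moments_cyclic Gconn isT e1 Gn.
have Gc l : l \in eigvals (signed_laplacian G (-1)) -> l < 4 :> R.
  by move/laplacian_eigval_le/le_lt_trans; apply; rewrite ltr_nat.
have Pb l :
  l \in eigvals (signed_laplacian (path_graph 3) (-1)) -> l <= 1 + 2 :> R.
  by move/laplacian_eigval_le/le_trans; apply; lra.
have := path_resolvent_le (n := 3) isT e1 c0 b1 Pb.
have := resolvent_ge e1 Gc c0.
have -> : 4 - 2 = 2 :> R by ring.
have -> : 2 + 2 = 4 :> R by ring.
have -> : 2 ^+ 2 * 4 * (2 - 1) = 16 :> R by ring.
have -> : 2 ^+ 4 * 4 = 64 :> R by ring.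
have -> : 2 ^+ 2 = 4 :> R by ring.
have -> : 2 ^+ 3 = 8 :> R by ring.
have -> : 2 ^+ 4 = 16 :> R by ring.
by lra.
Qed.

(** The hypothesis on [c] covers [c = n + 1] for the Laplacian, with [n = 3]
    apart, and [c = 2 n - 1] for the signless Laplacian. On at most 2 vertices
    the path is the only connected graph. *)
Lemma resolvent_path_le (R : realType) n (G : sgraph n) (e c : R) :
  connected_graph G -> (0 < n)%N -> e ^+ 2 = 1 ->
  (forall l, l \in eigvals (signed_laplacian G e) -> l < c) ->
  ((2 < n)%N -> 5 <= c /\ n%:R + 1 <= c \/ [/\ n = 3, e = -1 & c = 4]) ->
  \sum_(l <- eigvals (signed_laplacian (path_graph n) e)) 1 / (c - l) <=
  \sum_(l <- eigvals (signed_laplacian G e)) 1 / (c - l).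
Proof.
move=> Gconn n0 e1 Gc cn.
have := degsum_ge Gconn n0; rewrite leq_eqVlt => /orP[/eqP Gn|Gn].
  have [/forallP G2|] := boolP [forall i, (degree G i <= 2)%N].
    have [|s Gs] := path_iso Gconn G2 n0; first by rewrite -Gn.
    by rewrite (eigvals_slap_iso e Gs).
  case/forallPn => i; rewrite -ltnNge => Gi.
  have n3 : (2 < n)%N by exact: leq_trans Gi (ltnW (degree_lt G i)).
  have [[c5 nc]|[n3' _ _]] := cn n3.
    by apply: resolvent_path_le_tree => //; exists i.
  by have := leq_trans (degree_lt G i) (eq_leq n3'); rewrite ltnS leqNgt Gi.
have {}Gn : (2 * n <= degsum G)%N.
  have := degsum_even G; move: Gn; lia.
have n3 : (2 < n)%N.
  have : (degsum G <= n * n.-1)%N.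
    rewrite -[n in (n * _)%N]card_ord -sum_nat_const; apply: leq_sum => i _.
    by rewrite -ltnS prednK ?degree_lt.
  move/(leq_trans Gn); rewrite mulnC leq_pmul2l //.
  by case: (n) n0 => //.
have [[c5 nc]|[n3' e_1 c4]] := cn n3; first exact: resolvent_path_le_cyclic.
by move: Gn Gconn; subst n; subst e c; move=> ? ?; apply: laplacian_resolvent_3.
Qed.

Theorem corollary3p11 (R : realType) (n : nat) (G : sgraph n)
    (Gconn : connected_graph G) :
  RL R G >= RL R (path_graph n) /\ RQ R G >= RQ R (path_graph n).
Proof.
have lapE H : laplacian R H = signed_laplacian H (-1) :> 'M_n.
  by rewrite /laplacian /signed_laplacian scaleN1r.
have slapE H : signless_laplacian R H = signed_laplacian H 1 :> 'M_n.
  by rewrite /signless_laplacian /signed_laplacian scale1r.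
have e1 : (-1) ^+ 2 = 1 :> R by rewrite sqrrN expr1n.
case: (posnP n) => [n0|n0].
  have sum0 (F : 'I_n -> R) : \sum_(i < n) F i = 0.
    by apply: big1 => i _; have := leq_trans (ltn_ord i) (eq_leq n0).
  by split; rewrite [leLHS]sum0 [leRHS]sum0; exact: lexx.
split.
  rewrite /RL !lapE !(sum_lambda _ (fun l => 1 / (n%:R + 1 - l))).
  apply: resolvent_path_le => //.
    by move=> l /laplacian_eigval_le; lra.
  rewrite leq_eqVlt => /orP[/eqP<-|n4]; [right|left].
    by split=> //; rewrite natr1.
  have : 4 <= n%:R :> R by rewrite ler_nat.
  by move=> n4R; split; lra.
rewrite /RQ !slapE !(sum_lambda _ (fun l => 1 / (2 * n%:R - 1 - l))).
apply: resolvent_path_le; rewrite ?expr1n //.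
  have nE : n%:R = n.-1%:R + 1 :> R by rewrite natr1 prednK.
  move=> l /(slap_eigval_le (D := n.-1)); rewrite nE => ll.
  suff : l <= 2 * n.-1%:R by lra.
  by apply: ll => [|i]; rewrite ?expr1n // -ltnS prednK ?degree_lt.
move=> n3; left; have : 3 <= n%:R :> R by rewrite ler_nat.
by move=> n3R; split; lra.
Qed.
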